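(* Let $\mathcal R_4=\{(0^m1^na,4^l): m,n,l\ge0,\ a\in\{2,3\},\ (a=2\Rightarrow l=m)\wedge(a=3\Rightarrow l=n)\}\subseteq\{0,1,2,3\}^*\times\{4\}^*$. Then $\mathcal R_4$ can be computed with an isolated cutpoint both by a probabilistic finite state transducer and by a quantum finite state transducer, but neither by a probabilistic nor by a quantum finite state transducer can it be computed with probability $\alpha$ for any $\alpha>1/2$.
   Context: A probabilistic finite state transducer (pfst) is a tuple $T=(Q,\Sigma_1,\Sigma_2,V,f,q_0,Q_{\rm acc},Q_{\rm rej})$ with finite state set $Q$, finite input/output alphabets $\Sigma_1,\Sigma_2$, initial state $q_0$, disjoint accepting/rejecting sets $Q_{\rm acc},Q_{\rm rej}\subseteq Q$ (the other states are non-halting). For each $a\in\Sigma_1\cup\{\ddagger,\$\}$ ($\ddagger,\$$ are end markers) there is a stochastic $Q\times Q$ matrix $V_a$ and an output function $f_a:Q\to\Sigma_2^*$; $V_\$$ puts all probability on halting states. On input $v$ the machine reads $\ddagger v\$$; in state $q$ reading $a$ it appends $f_a(q)$ to the output tape and moves to state $p$ with probability $(V_a)_{qp}$; if $p$ is accepting (rejecting) it halts and accepts with the current output (rejects). $T(w|v)$ is the probability of accepting with output $w$ on input $v$. A quantum finite state transducer (qfst) has the same data except that each $V_a$ is a unitary on $\ell^2(Q)$ (and $V_\$$ maps the span of non-halting states into the span of halting states). Its non-halting part is a vector $\psi=\sum_{q,w}\alpha_{qw}|q\rangle\otimes|w\rangle\in\ell^2(Q\times\Sigma_2^* )$, initially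 $|q_0\rangle\otimes|\epsilon\rangle$; reading $a$ maps it to $\psi'=\sum_{q,w}\alpha_{qw}V_a|q\rangle\otimes|wf_a(q)\rangle$ with $V_a|q\rangle=\sum_p(V_a)_{qp}|p\rangle$, after which the squared norm of the component of $\psi'$ on $\mathrm{span}(Q_{\rm acc})\otimes|x\rangle$ is added to the probability of accepting with output $x$, the squared norm of the component on $\mathrm{span}(Q_{\rm rej})\otimes\ell^2(\Sigma_2^* )$ to the rejection probability, and the computation continues with the projection onto non-halting states. $T(w|v)$ is defined analogously. For $\alpha>1/2$, $T$ computes $\mathcal R$ with probability $\alpha$ if for all $v,w$: $(v,w)\in\mathcal R\Rightarrow T(w|v)\ge\alpha$ and $(v,w)\notin\mathcal R\Rightarrow T(w|v)\le1-\alpha$. $T$ computes $\mathcal R$ with isolated cutpoint if there are $0<\alpha<1$ and $\varepsilon>0$ such that for all $v,w$: $(v,w)\in\mathcal R\Rightarrow T(w|v)\ge\alpha+\varepsilon$ and $(v,w)\notin\mathcal R\Rightarrow T(w|v)\le\alpha-\varepsilon$. *)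

(* Defs.v *)
From HB Require Import structures.
From mathcomp Require Import all_boot all_algebra.
From mathcomp Require Import reals complex.
Set Implicit Arguments. Unset Strict Implicit. Unset Printing Implicit Defensive.
Import GRing.Theory Num.Theory.
Local Open Scope ring_scope.

Inductive sym (S1 : Type) := Letter of S1 | LEnd | REnd.
Arguments LEnd {S1}. Arguments REnd {S1}.

Definition tape (S1 : Type) (v : seq S1) : seq (sym S1) :=
  LEnd :: map (@Letter S1) v ++ [:: REnd].

Record pfst (R : realType) (S1 S2 : finType) := Pfst {
  pstate : finType;
  pV : sym S1 -> pstate -> pstate -> R;
  pf : sym S1 -> pstate -> seq S2;
  pq0 : pstate;
  pacc : {set pstate};
  prej : {set pstate} }.
Arguments pstate {R S1 S2} p.
Arguments pV {R S1 S2} p _ _ _.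
Arguments pf {R S1 S2} p _ _.
Arguments pq0 {R S1 S2} p.
Arguments pacc {R S1 S2} p.
Arguments prej {R S1 S2} p.

Definition p_halting R S1 S2 (T : pfst R S1 S2) (q : pstate T) : bool :=
  (q \in pacc T) || (q \in prej T).
Arguments p_halting {R S1 S2} T q.

Definition pfst_wf R S1 S2 (T : pfst R S1 S2) : Prop :=
  [/\ [disjoint pacc T & prej T],
      ~~ p_halting T (pq0 T),
      (forall a q p, 0 <= pV T a q p),
      (forall a q, \sum_(p : pstate T) pV T a q p = 1) &
      (forall q p, ~~ p_halting T p -> pV T REnd q p = 0)].

(* Non-halting part: a formal finite combination of configurations
   (state, output so far, weight). *)
Definition pstep R S1 S2 (T : pfst R S1 S2) (a : sym S1)
    (cfg : seq (pstate T * seq S2 * R)) : seq (pstate T * seq S2 * R) :=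
  flatten [seq [seq (p, c.1.2 ++ pf T a c.1.1, c.2 * pV T a c.1.1 p)
               | p <- enum (pstate T)] | c <- cfg].

Fixpoint prun R S1 S2 (T : pfst R S1 S2) (cfg : seq (pstate T * seq S2 * R))
    (t : seq (sym S1)) (x : seq S2) : R :=
  match t with
  | [::] => 0
  | a :: t' =>
      let c' := pstep a cfg in
      \sum_(c <- c' | (c.1.1 \in pacc T) && (c.1.2 == x)) c.2
      + prun [seq c <- c' | ~~ p_halting T c.1.1] t' x
  end.

Definition pT R S1 S2 (T : pfst R S1 S2) (w : seq S2) (v : seq S1) : R :=
  prun [:: (pq0 T, [::], 1)] (tape v) w.

(* qV a q p = (V_a)_{qp}, i.e. V_a|q> = sum_p (V_a)_{qp} |p>.           *)
Record qfst (R : realType) (S1 S2 : finType) := Qfst {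
  qstate : finType;
  qV : sym S1 -> qstate -> qstate -> R[i];
  qf : sym S1 -> qstate -> seq S2;
  qq0 : qstate;
  qacc : {set qstate};
  qrej : {set qstate} }.
Arguments qstate {R S1 S2} q.
Arguments qV {R S1 S2} q _ _ _.
Arguments qf {R S1 S2} q _ _.
Arguments qq0 {R S1 S2} q.
Arguments qacc {R S1 S2} q.
Arguments qrej {R S1 S2} q.

Definition q_halting R S1 S2 (T : qfst R S1 S2) (q : qstate T) : bool :=
  (q \in qacc T) || (q \in qrej T).
Arguments q_halting {R S1 S2} T q.

Definition q_unitary (R : realType) (Q : finType) (V : Q -> Q -> R[i]) : Prop :=
  forall q q', \sum_(p : Q) V q p * (V q' p)^* = (q == q')%:R.

Definition qfst_wf R S1 S2 (T : qfst R S1 S2) : Prop :=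
  [/\ [disjoint qacc T & qrej T],
      ~~ q_halting T (qq0 T),
      (forall a, q_unitary (qV T a)) &
      (forall q p, ~~ q_halting T q -> ~~ q_halting T p -> qV T REnd q p = 0)].

Definition csqnorm (R : realType) (z : R[i]) : R := (complex.Re z) ^+ 2 + (complex.Im z) ^+ 2.

(* psi is represented as a formal finite sum of terms alpha |q> (x) |w>. *)
Definition qstep R S1 S2 (T : qfst R S1 S2) (a : sym S1)
    (psi : seq (qstate T * seq S2 * R[i])) : seq (qstate T * seq S2 * R[i]) :=
  flatten [seq [seq (p, c.1.2 ++ qf T a c.1.1, c.2 * qV T a c.1.1 p)
               | p <- enum (qstate T)] | c <- psi].

(* squared norm of the component of psi on span(Q_acc) (x) |x> *)
Definition qacc_prob R S1 S2 (T : qfst R S1 S2)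
    (psi : seq (qstate T * seq S2 * R[i])) (x : seq S2) : R :=
  \sum_(p in qacc T)
     csqnorm (\sum_(c <- psi | (c.1.1 == p) && (c.1.2 == x)) c.2).

Fixpoint qrun R S1 S2 (T : qfst R S1 S2) (psi : seq (qstate T * seq S2 * R[i]))
    (t : seq (sym S1)) (x : seq S2) : R :=
  match t with
  | [::] => 0
  | a :: t' =>
      let psi' := qstep a psi in
      qacc_prob psi' x + qrun [seq c <- psi' | ~~ q_halting T c.1.1] t' x
  end.

Definition qT R S1 S2 (T : qfst R S1 S2) (w : seq S2) (v : seq S1) : R :=
  qrun [:: (qq0 T, [::], 1)] (tape v) w.

Definition computes_with_prob (R : realType) (S1 S2 : Type) (Tm : seq S2 -> seq S1 -> R)
    (Rel : seq S1 -> seq S2 -> Prop) (alpha : R) : Prop :=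
  forall v w, (Rel v w -> alpha <= Tm w v) /\ (~ Rel v w -> Tm w v <= 1 - alpha).

Definition computes_isolated (R : realType) (S1 S2 : Type) (Tm : seq S2 -> seq S1 -> R)
    (Rel : seq S1 -> seq S2 -> Prop) : Prop :=
  exists alpha eps : R, [/\ 0 < alpha, alpha < 1, 0 < eps &
    forall v w, (Rel v w -> alpha + eps <= Tm w v) /\
                (~ Rel v w -> Tm w v <= alpha - eps)].

(* The relation R_4.  Input alphabet {0,1,2,3} = 'I_4; output alphabet
   {4} is the one-letter type unit, the letter 4 being tt.               *)
Definition Sigma1 := 'I_4.
Definition Sigma2 := unit.
Definition sym4 (k : nat) : Sigma1 := inord k.

Definition R4 (v : seq Sigma1) (w : seq Sigma2) : Prop :=
  exists (m n l : nat) (a : Sigma1),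
    [/\ a = sym4 2 \/ a = sym4 3,
        v = nseq m (sym4 0) ++ nseq n (sym4 1) ++ [:: a],
        w = nseq l tt,
        (a = sym4 2 -> l = m) &
        (a = sym4 3 -> l = n)].

(* Main.v *)
(* Impossibility: on the inputs 1^n 2 and 1^n 3 the machine is in the same
   (mixed or superposed) configuration after reading 1^n, and the two remaining
   symbols 2$ or 3$ append only boundedly many letters. For large n, accepting
   1^n 2 with the empty output and accepting 1^n 3 with output 4^n draw on
   disjoint parts of the total mass 1 (probability, or squared norm), so the
   two probabilities cannot both exceed 1/2.
   Possibility: branch at the left end marker into two copies of the machine,
   one outputting the 0s and accepting on the final letter 2, the other
   outputting the 1s and accepting on 3. Probabilistically this accepts with
   probability 1/2 or 0. In the quantum case each copy checks the form 0*1*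
   reversibly, as in the Ambainis-Freivalds automaton: reading 0 fixes
   |A0> + |A1> and sends |A0> - |A1> to rejecting states, while reading 1 keeps
   only |A1>. Every return from 1s to 0s halves the amplitude, so malformed
   inputs are accepted with probability at most 1/8, against 1/4. *)
Require Import Defs.
From HB Require Import structures.
From mathcomp Require Import all_boot all_order all_algebra all_fingroup.
From mathcomp Require Import reals complex.
From mathcomp Require Import zify lra ring.
Import Order.TTheory GRing.Theory Num.Theory.
Local Open Scope ring_scope.

Set Implicit Arguments.
Unset Strict Implicit.

Lemma eqseq_catr (T : eqType) (u s t : seq T) : (s ++ u == t ++ u) = (s == t).
Proof.
apply/eqP/eqP => [e|->//]; have := congr1 size e; rewrite !size_cat => /addIn.
by move: e => /eqP + sz; rewrite eqseq_cat // eqxx andbT => /eqP.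
Qed.

(** * Weighted configurations and linear functionals on them *)

Section LinearRuns.
Context {A : pzRingType} {Q : finType} {S2 : eqType}.
Implicit Types (V : Q -> Q -> A) (f : Q -> seq S2).
Implicit Types (cfg : seq (Q * seq S2 * A)) (g : Q * seq S2 -> A).

(** Common form of [pstep] and [qstep] at one symbol, over any coefficient ring, so that both kinds
    of machine share the lemmas on runs. *)
Definition wstep V f cfg : seq (Q * seq S2 * A) :=
  flatten [seq [seq (p, c.1.2 ++ f c.1.1, c.2 * V c.1.1 p) | p <- enum Q]
          | c <- cfg].

Definition lin cfg g : A := \sum_(c <- cfg) c.2 * g c.1.

(** The transpose of [wstep]: it moves a step from a configuration to the functional paired with it
    by [lin]. *)
Definition pull V f g (k : Q * seq S2) : A :=
  \sum_p V k.1 p * g (p, k.2 ++ f k.1).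

Lemma big_wstep (B : nmodType) (F : Q * seq S2 * A -> B) V f cfg :
  \sum_(c <- wstep V f cfg) F c =
  \sum_(c <- cfg) \sum_p F (p, c.1.2 ++ f c.1.1, c.2 * V c.1.1 p).
Proof.
rewrite big_flatten big_map; apply: eq_bigr => c _.
by rewrite big_map big_enum.
Qed.

Lemma lin_step V f cfg g : lin (wstep V f cfg) g = lin cfg (pull V f g).
Proof.
rewrite /lin big_wstep; apply: eq_bigr => c _; rewrite mulr_sumr.
by apply: eq_bigr => p _; rewrite mulrA.
Qed.

Lemma lin_filter (P : pred (Q * seq S2)) cfg g :
  lin [seq c <- cfg | P c.1] g = lin cfg (fun k => if P k then g k else 0).
Proof.
rewrite /lin big_filter big_mkcond; apply: eq_bigr => c _.
by case: (P c.1); rewrite ?mulr0.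
Qed.

Lemma eq_lin g g' cfg : g =1 g' -> lin cfg g = lin cfg g'.
Proof. by move=> eg; apply: eq_bigr => c _; rewrite eg. Qed.

Lemma lin_seq1 k g : lin [:: (k, 1)] g = g k.
Proof. by rewrite /lin big_seq1 mul1r. Qed.

End LinearRuns.

(** * Disjoint outputs carry disjoint mass *)

Section Separation.
Context {R : realDomainType} {A : pzRingType} {Q : finType} {S1 : Type}.
Context {S2 : eqType}.
Variables (V : sym S1 -> Q -> Q -> A) (f : sym S1 -> Q -> seq S2).
Variables (acc hlt : pred Q).
(** [mass] stands for total absolute weight or for the squared norm, [accp] for the probability of
    accepting now with a given output. *)
Variables (mass : seq (Q * seq S2 * A) -> R).
Variables (accp : seq (Q * seq S2 * A) -> seq S2 -> R).

Hypothesis acc_hlt : forall q, acc q -> hlt q.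
Hypothesis mass_ge0 : forall cfg, 0 <= mass cfg.
Hypothesis mass_split : forall (P : pred (Q * seq S2)) cfg,
  mass cfg = mass [seq c <- cfg | P c.1] + mass [seq c <- cfg | ~~ P c.1].
Hypothesis mass_step : forall a cfg, mass (wstep (V a) (f a) cfg) = mass cfg.
Hypothesis accp_le : forall cfg x,
  accp cfg x <= mass [seq c <- cfg | acc c.1.1 && (c.1.2 == x)].

Fixpoint run (cfg : seq (Q * seq S2 * A)) (t : seq (sym S1)) (x : seq S2) : R :=
  match t with
  | [::] => 0
  | a :: t' =>
      let c' := wstep (V a) (f a) cfg in
      accp c' x + run [seq c <- c' | ~~ hlt c.1.1] t' x
  end.

(** Bounds the number of letters that can be appended while [t] is read. *)
Definition reach (t : seq (sym S1)) : nat :=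
  \sum_(a <- t) \max_(q : Q) size (f a q).

(** A necessary condition, on lengths only, for the output so far to grow into [x] by at most [L]
    further letters. *)
Definition window (x : seq S2) (L : nat) (k : Q * seq S2) : bool :=
  (size k.2 <= size x <= size k.2 + L)%N.

Lemma mass_filter_le (P P' : pred (Q * seq S2)) cfg :
  (forall k, P k -> P' k) ->
  mass [seq c <- cfg | P c.1] <= mass [seq c <- cfg | P' c.1].
Proof.
move=> PP'; rewrite (mass_split P [seq c <- cfg | P' c.1]) -filter_predI.
rewrite (@eq_filter _ _ (fun c => P c.1)); last first.
  by move=> c /=; case: (boolP (P c.1)) => // /PP' ->.
by rewrite lerDl mass_ge0.
Qed.

Lemma mass_filter2_le (P P' P'' : pred (Q * seq S2)) cfg :
  (forall k, P k -> P'' k) -> (forall k, P' k -> P'' k) ->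
  (forall k, P k -> ~~ P' k) ->
  mass [seq c <- cfg | P c.1] + mass [seq c <- cfg | P' c.1]
    <= mass [seq c <- cfg | P'' c.1].
Proof.
move=> PP'' P'P'' PP'; rewrite (mass_split P [seq c <- cfg | P'' c.1]).
rewrite -!filter_predI; apply: lerD.
  apply: (mass_filter_le (P' := fun k => P k && P'' k)) => k Pk.
  by rewrite Pk PP''.
apply: (mass_filter_le (P' := fun k => ~~ P k && P'' k)) => k P'k.
by rewrite P'P'' // andbT; apply/negP => /PP'; rewrite P'k.
Qed.

(** Mass accepted now with output [x] and mass that continues are disjoint, since accepting states
    halt. Both lie in the window for the remaining symbols, and undoing the step widens that window
    by the longest output of the step. *)
Lemma run_window t cfg x :
  run cfg t x <= mass [seq c <- cfg | window x (reach t) c.1].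
Proof.
elim: t cfg => [|a t IH] cfg /=; first exact: mass_ge0.
set c' := wstep _ _ _.
apply: (@le_trans _ _ (mass [seq c <- c' | window x (reach t) c.1])).
  apply: le_trans (lerD (accp_le _ _) (IH _)) _.
  rewrite -filter_predI.
  apply: (@mass_filter2_le (fun k => acc k.1 && (k.2 == x))
    (fun k => window x (reach t) k && ~~ hlt k.1)) => //.
  - by move=> k /andP[_ /eqP <-]; rewrite /window leqnn leq_addr.
  - by move=> k /andP[].
  - by move=> k /andP[/acc_hlt hk _]; rewrite hk andbF.
rewrite -[leRHS](mass_step a).
(* Outside the wider window no configuration has a successor in the narrower one, so the
   configuration may be filtered before the step. *)
suff -> : [seq c <- c' | window x (reach t) c.1] =
  [seq c <- wstep (V a) (f a) [seq c <- cfg | window x (reach (a :: t)) c.1]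
  | window x (reach t) c.1].
  by rewrite [leRHS](mass_split (window x (reach t))) lerDl mass_ge0.
rewrite {}/c' /wstep; elim: cfg => [|c cfg IHc] //=.
rewrite filter_cat IHc; case: ifP => [_|out] /=; first by rewrite filter_cat.
rewrite (@eq_in_filter _ _ pred0) ?filter_pred0 // => d /mapP[p _ ->] /=.
apply: contraFF out; rewrite /window /= size_cat => /andP[le1 le2].
rewrite /reach big_cons -/(reach t).
have le3 : (size (f a c.1.1) <= \max_q size (f a q))%N by exact: leq_bigmax.
by apply/andP; split; lia.
Qed.

Fixpoint residue (cfg : seq (Q * seq S2 * A)) (t : seq (sym S1)) :=
  if t is a :: t' then
    residue [seq c <- wstep (V a) (f a) cfg | ~~ hlt c.1.1] t'
  else cfg.

Lemma run_cat cfg s t x :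
  run cfg (s ++ t) x = run cfg s x + run (residue cfg s) t x.
Proof. by elim: s cfg => [|a s IH] cfg /=; rewrite ?add0r // IH addrA. Qed.

(** Mass that accepts [x], mass that accepts [y] and mass still running are disjoint parts of a
    total that each step preserves. *)
Lemma run_residue_le cfg s x y : x != y ->
  run cfg s x + run cfg s y + mass (residue cfg s) <= mass cfg.
Proof.
move=> xy; elim: s cfg => [|a s IH] cfg /=; first by rewrite !add0r.
set c' := wstep _ _ _; rewrite -(mass_step a cfg) -/c'.
rewrite (mass_split (fun k => hlt k.1) c').
rewrite addrACA -[leLHS]addrA; apply: lerD; last exact: IH.
apply: le_trans (lerD (accp_le _ _) (accp_le _ _)) _.
apply: (@mass_filter2_le (fun k => acc k.1 && (k.2 == x))
  (fun k => acc k.1 && (k.2 == y)) (fun k => hlt k.1)) => k /andP[/acc_hlt //].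
by move=> _ /eqP ->; rewrite (negbTE xy) andbF.
Qed.

(* After a common prefix, the suffix [t'] is too short to turn an output
   prefix of [x] into [y]; the two outputs thus draw on disjoint mass. *)
Lemma run_exclusive cfg s t t' x y :
  (size x + reach t' < size y)%N ->
  run cfg (s ++ t) x + run cfg (s ++ t') y <= mass cfg.
Proof.
move=> xy; rewrite !run_cat.
have nxy : x != y by apply: contraTneq xy => ->; lia.
apply: le_trans (run_residue_le cfg s nxy).
rewrite addrACA lerD2l.
apply: le_trans (lerD (run_window _ _ _) (run_window _ _ _)) _.
rewrite -[leRHS](@congr1 _ _ mass _ _ (filter_predT _)).
apply: (@mass_filter2_le (window x (reach t)) (window y (reach t')) xpredT)
  => //.
by move=> k; rewrite /window => /andP[k1 k2]; apply/negP => /andP[k3 k4]; lia.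
Qed.

End Separation.

(** * Total probability as mass *)

Section ProbabilisticMass.
Context {R : realType} {S1 S2 : finType} (T : pfst R S1 S2).

Definition paccp (cfg : seq (pstate T * seq S2 * R)) (x : seq S2) : R :=
  \sum_(c <- cfg | (c.1.1 \in pacc T) && (c.1.2 == x)) c.2.

Lemma prun_run cfg t x :
  prun cfg t x = run (pV T) (pf T) (p_halting T) paccp cfg t x.
Proof. by elim: t cfg => //= a t IH cfg; rewrite IH. Qed.

(** Absolute values make this nonnegative on every formal combination, whatever the signs of its
    weights. *)
Definition pmass (cfg : seq (pstate T * seq S2 * R)) : R :=
  \sum_(c <- cfg) `|c.2|.

Hypothesis Twf : pfst_wf T.

Lemma pfst_exclusive s t t' x y :
  (size x + reach (pf T) t' < size y)%N ->
  prun [:: (pq0 T, [::], 1)] (s ++ t) x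
    + prun [:: (pq0 T, [::], 1)] (s ++ t') y <= 1.
Proof.
move=> xy; have [_ _ V0 V1 _] := Twf.
have mass1 : pmass [:: (pq0 T, [::], 1)] = 1 by rewrite /pmass big_seq1 normr1.
rewrite !prun_run -[leRHS]mass1.
apply: (run_exclusive (acc := [in pacc T])) xy => //.
- by move=> q /= qa; rewrite /p_halting qa.
- by move=> cfg; apply: sumr_ge0.
- by move=> P cfg; rewrite /pmass !big_filter; exact: bigID.
- move=> a cfg; rewrite /pmass big_wstep; apply: eq_bigr => c _ /=.
  under eq_bigr do rewrite normrM (ger0_norm (V0 _ _ _)).
  by rewrite -mulr_sumr V1 mulr1.
- move=> cfg z; rewrite /paccp /pmass big_filter.
  by apply: ler_sum => c _; exact: ler_norm.
Qed.

End ProbabilisticMass.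

(** * Squared norm as mass *)

Section QuantumMass.
Context {R : realType} {S1 S2 : finType} (T : qfst R S1 S2).
Implicit Types psi : seq (qstate T * seq S2 * R[i]).

(** A formal sum may list a basis vector several times; this is its actual coefficient. *)
Definition amp psi (k : qstate T * seq S2) : R[i] :=
  \sum_(d <- psi | d.1 == k) d.2.

Lemma qrun_run psi t x : qrun psi t x =
  run (qV T) (qf T) (q_halting T) (@qacc_prob R S1 S2 T) psi t x.
Proof. by elim: t psi => //= a t IH psi; rewrite IH. Qed.

(* The squared norm of [psi] as a vector in l^2(Q x S2^* ). *)
Definition gram psi : R[i] := lin psi (fun k => (amp psi k)^*).

Lemma csqnormE (z : R[i]) : (csqnorm z)%:C%C = z * z^*.
Proof. by rewrite add_Re2_Im2 normCK. Qed.

(** Amplitudes combine only equal basis vectors, so a split by a property of basis vectors is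
    orthogonal. *)
Lemma gram_split (P : pred (qstate T * seq S2)) psi :
  gram psi = gram [seq c <- psi | P c.1] + gram [seq c <- psi | ~~ P c.1].
Proof.
rewrite /gram /lin (bigID (fun c => P c.1)) !big_filter.
congr (_ + _); apply: eq_bigr => c /= Pc; congr (_ * _^* );
  rewrite /amp big_filter_cond.
  by apply: eq_bigl => d; case: eqP => [->|]; rewrite ?Pc ?andbF.
by apply: eq_bigl => d; case: eqP => [->|]; rewrite ?Pc ?andbF.
Qed.

Lemma gram_pred1 psi k :
  gram [seq c <- psi | c.1 == k] = (csqnorm (amp psi k))%:C%C.
Proof.
rewrite csqnormE /gram /lin big_filter {1}/amp mulr_suml.
apply: eq_bigr => c /eqP ->; congr (_ * _^* ).
by rewrite /amp big_filter_cond; apply: eq_bigl => d; rewrite andbb.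
Qed.

(** Splitting off all terms at the basis vector of the head contributes the squared modulus of one
    amplitude and leaves a shorter list. *)
Lemma gram_ge0 psi : 0 <= gram psi.
Proof.
have [n] := ubnP (size psi); elim: n psi => // n IH [|c psi] /=.
  by rewrite /gram /lin big_nil.
rewrite ltnS => sz; rewrite (gram_split (pred1 c.1)) addr_ge0 //.
  by rewrite gram_pred1 csqnormE mul_conjC_ge0.
apply: IH => /=; rewrite eqxx /=; apply: leq_ltn_trans sz.
by rewrite size_filter count_size.
Qed.

Hypothesis Twf : qfst_wf T.

(** Terms from distinct states cancel by unitarity even when their new outputs agree. Terms from the
    same state append the same word, so their outputs agree after the step exactly when they did
    before. *)
Lemma gram_step a psi : gram (wstep (qV T a) (qf T a) psi) = gram psi.
Proof.
have [_ _ U _] := Twf.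
rewrite {1}/gram lin_step; apply: eq_lin => -[q w]; rewrite /pull /amp /=.
transitivity (\sum_p \sum_(d <- psi | d.1.2 ++ qf T a d.1.1 == w ++ qf T a q)
    qV T a q p * (d.2 * qV T a d.1.1 p)^*).
  apply: eq_bigr => p _; rewrite big_mkcond big_wstep rmorph_sum mulr_sumr /=.
  rewrite [RHS]big_mkcond; apply: eq_bigr => d _; rewrite (bigD1 p) //= big1.
    rewrite addr0 xpair_eqE eqxx /=; case: ifP; by rewrite ?rmorph0 ?mulr0.
  by move=> p' /negbTE pp'; rewrite xpair_eqE pp'.
rewrite exchange_big /= rmorph_sum big_mkcond [RHS]big_mkcond.
apply: eq_bigr => d _ /=.
transitivity (if d.1.2 ++ qf T a d.1.1 == w ++ qf T a q
  then d.2^* * (q == d.1.1)%:R else 0).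
  case: ifP => // _; rewrite -(U a) mulr_sumr; apply: eq_bigr => p _.
  by rewrite rmorphM mulrCA.
case: d => [[q' w'] z] /=; rewrite xpair_eqE [q' == q]eq_sym.
case: (q =P q') => [<-|_] /=; last by rewrite mulr0 if_same.
by rewrite eqseq_catr mulr1.
Qed.

(** The vectors [(p, x)] with [p] accepting are orthogonal, so their squared moduli add up to the
    squared norm of that part of [psi]. *)
Lemma qacc_probE psi x : (qacc_prob psi x)%:C%C =
  gram [seq c <- psi | (c.1.1 \in qacc T) && (c.1.2 == x)].
Proof.
pose ind (p : qstate T) (k : qstate T * seq S2) := k == (p, x).
transitivity (\sum_(p in qacc T) gram [seq c <- psi | ind p c.1]).
  rewrite /qacc_prob rmorph_sum; apply: eq_bigr => p _ /=.
  by rewrite gram_pred1 /amp; congr ((csqnorm _)%:C%C).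
transitivity (\sum_(p in qacc T)
    \sum_(c <- psi | ind p c.1) c.2 * (amp psi c.1)^*).
  apply: eq_bigr => p _; rewrite /gram /lin big_filter.
  apply: eq_bigr => c /eqP ->; congr (_ * _^* ).
  rewrite /amp big_filter_cond; apply: eq_bigl => d; rewrite /ind.
  by case: eqP => // ->; rewrite eqxx.
rewrite [RHS](_ : _ = \sum_(c <- psi | (c.1.1 \in qacc T) && (c.1.2 == x))
    c.2 * (amp psi c.1)^*); last first.
  rewrite /gram /lin big_filter; apply: eq_bigr => c cP; congr (_ * _^* ).
  rewrite /amp big_filter_cond; apply: eq_bigl => d.
  by case: (d.1 =P c.1) => [->|]; rewrite ?cP ?andbF.
under eq_bigr do rewrite big_mkcond.
rewrite exchange_big /= [RHS]big_mkcond; apply: eq_bigr => -[[q w] z] _ /=.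
rewrite -big_mkcondr /= /ind.
under eq_bigl do rewrite xpair_eqE [q == _]eq_sym andbA.
case: (w == x); last by rewrite andbF big1 // => p; rewrite andbF.
rewrite andbT; case: ifP => qa; last first.
  by rewrite big1 // => p /andP[/andP[pa /eqP pq] _]; rewrite -pq pa in qa.
rewrite (big_pred1 q) // => p /=.
by rewrite andbT; case: eqP => [->|]; rewrite ?qa ?andbF.
Qed.

Lemma qfst_exclusive s t t' x y :
  (size x + reach (qf T) t' < size y)%N ->
  qrun [:: (qq0 T, [::], 1)] (s ++ t) x
    + qrun [:: (qq0 T, [::], 1)] (s ++ t') y <= 1.
Proof.
move=> xy; have gram1 : complex.Re (gram [:: (qq0 T, [::], 1)]) = 1.
  by rewrite /gram lin_seq1 /amp big_cons big_nil eqxx addr0 rmorph1.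
rewrite !qrun_run -[leRHS]gram1; apply: (run_exclusive (acc := [in qacc T])
  (mass := fun psi => complex.Re (gram psi))) xy => //.
- by move=> q /= qa; rewrite /q_halting qa.
- by move=> psi; have := gram_ge0 psi; rewrite lecE => /andP[].
- move=> P psi; rewrite {1}(gram_split P).
  by case: (gram _) => ? ?; case: (gram _).
- by move=> a psi; rewrite gram_step.
- by move=> psi z; rewrite -qacc_probE.
Qed.

End QuantumMass.

(** * No machine computes the relation with probability above 1/2 *)

Section Impossibility.
Context {R : realType}.

Definition block_word (n : nat) (a : Sigma1) : seq Sigma1 :=
  nseq n (sym4 1) ++ [:: a].

Lemma tape_block n a : tape (block_word n a) =
  (LEnd :: map (@Letter _) (nseq n (sym4 1))) ++ [:: Letter a; REnd].
Proof. by rewrite /tape /block_word map_cat -catA. Qed.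

Lemma sym4_23 : sym4 2 <> sym4 3.
Proof. by move/(congr1 val); rewrite /= !inordK. Qed.

Lemma R4_block2 n : R4 (block_word n (sym4 2)) [::].
Proof.
by exists 0%N, n, 0%N, (sym4 2); split; [left| | |  |move/sym4_23].
Qed.

Lemma R4_block3 n : R4 (block_word n (sym4 3)) (nseq n tt).
Proof.
by exists 0%N, n, n, (sym4 3); split; [right| | | move/esym/sym4_23 |].
Qed.

Lemma no_majority (Tm : seq Sigma2 -> seq Sigma1 -> R) (n : nat) (alpha : R) :
  Tm [::] (block_word n (sym4 2))
    + Tm (nseq n tt) (block_word n (sym4 3)) <= 1 ->
  1 / 2 < alpha -> ~ computes_with_prob Tm R4 alpha.
Proof.
move=> le1 alpha_gt cmp.
have [/(_ (R4_block2 n)) h2 _] := cmp (block_word n (sym4 2)) [::].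
have [/(_ (R4_block3 n)) h3 _] := cmp (block_word n (sym4 3)) (nseq n tt).
lra.
Qed.

Lemma pfst_no_majority (T : pfst R Sigma1 Sigma2) (alpha : R) :
  pfst_wf T -> 1 / 2 < alpha -> ~ computes_with_prob (pT T) R4 alpha.
Proof.
move=> Twf.
(* One more than the reach of the suffix [3$], which therefore cannot turn the empty output into one
   of this length. *)
apply: (@no_majority _ (reach (pf T) [:: Letter (sym4 3); REnd]).+1).
by rewrite /pT !tape_block pfst_exclusive // size_nseq.
Qed.

Lemma qfst_no_majority (T : qfst R Sigma1 Sigma2) (alpha : R) :
  qfst_wf T -> 1 / 2 < alpha -> ~ computes_with_prob (qT T) R4 alpha.
Proof.
move=> Twf.
apply: (@no_majority _ (reach (qf T) [:: Letter (sym4 3); REnd]).+1).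
by rewrite /qT !tape_block qfst_exclusive // size_nseq.
Qed.

End Impossibility.

(** * Runs that accept only at the right end marker *)

Section Pullback.
Context {A : pzRingType} {Q : finType} {S1 : Type} {S2 : eqType}.
Variables (V : sym S1 -> Q -> Q -> A) (f : sym S1 -> Q -> seq S2).
Variable hlt : pred Q.

(* Amplitude with which a configuration evolves, through non-halting states,
   along [s] and the right end marker into the functional [g]. *)
Fixpoint pullback (s : seq (sym S1)) (g : Q * seq S2 -> A) : Q * seq S2 -> A :=
  if s is a :: s' then
    pull (V a) (f a) (fun k => if ~~ hlt k.1 then pullback s' g k else 0)
  else pull (V REnd) (f REnd) g.

Definition at_config (p : Q) (x : seq S2) (k : Q * seq S2) : A :=
  (k == (p, x))%:R.

End Pullback.

Lemma lin_at_config (A : pzRingType) (Q : finType) (S2 : eqType)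
    (cfg : seq (Q * seq S2 * A)) p x :
  lin cfg (at_config p x) =
  \sum_(c <- cfg | (c.1.1 == p) && (c.1.2 == x)) c.2.
Proof.
rewrite /lin [RHS]big_mkcond; apply: eq_bigr => -[[q w] a] _ /=.
by rewrite /at_config xpair_eqE; case: andb; rewrite ?mulr1 ?mulr0.
Qed.

Lemma paccpE (R : realType) (S1 S2 : finType) (T : pfst R S1 S2) cfg x :
  paccp cfg x = \sum_(p in pacc T) lin cfg (at_config p x).
Proof.
under eq_bigr do rewrite lin_at_config big_mkcond.
rewrite exchange_big /paccp big_mkcond; apply: eq_bigr => -[[q w] a] _ /=.
case: (w == x); last by rewrite andbF big1 // => p; rewrite andbF.
rewrite andbT -big_mkcondr; under eq_bigl do rewrite andbT.
case: ifP => qa; last first.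
  by rewrite big1 // => p /andP[pa /eqP qp]; rewrite qp pa in qa.
rewrite (big_pred1 q) // => p; rewrite /= eq_sym.
by case: eqP => [->|]; rewrite ?qa ?andbF.
Qed.

Lemma qacc_prob_lin (R : realType) (S1 S2 : finType) (T : qfst R S1 S2) psi x :
  qacc_prob psi x = \sum_(p in qacc T) csqnorm (lin psi (at_config p x)).
Proof. by apply: eq_bigr => p _; rewrite lin_at_config. Qed.

(** All acceptance happens at the right end marker, so only the last summand of the run survives.
    [N] turns an amplitude into a probability: the identity or [csqnorm]. *)
Lemma run_accept_at_end (R : realDomainType) (A : pzRingType) (Q : finType)
    (S1 : Type) (S2 : eqType) (V : sym S1 -> Q -> Q -> A)
    (f : sym S1 -> Q -> seq S2) (acc : {set Q}) (hlt : pred Q) (N : A -> R)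
    (accp : seq (Q * seq S2 * A) -> seq S2 -> R) cfg v x :
  N 0 = 0 ->
  (forall cfg x, accp cfg x = \sum_(p in acc) N (lin cfg (at_config p x))) ->
  (forall a q p, ~~ hlt q -> p \in acc -> V (Letter a) q p = 0) ->
  (forall q p, ~~ hlt q -> p \in acc -> V LEnd q p = 0) ->
  all (fun c => ~~ hlt c.1.1) cfg ->
  run V f hlt accp cfg (tape v) x =
  \sum_(p in acc)
    N (lin cfg (pullback V f hlt (LEnd :: map (@Letter S1) v) (at_config p x))).
Proof.
move=> N0 accpE VL VE; rewrite /tape -cat_cons.
have: all (fun a => if a is REnd then false else true)
    (LEnd :: [seq Letter i | i <- v]) by rewrite /=; elim: v.
elim: (LEnd :: _) cfg => [|a s IH] cfg /= => [_ _|/andP[aE sE] cfgN].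
  by rewrite addr0 accpE; apply: eq_bigr => p _; rewrite lin_step.
rewrite IH // ?all_filter; last by apply/allP => c _; apply/implyP.
rewrite accpE big1 ?add0r => [|p pa].
  by apply: eq_bigr => p _; rewrite (lin_filter (fun k => ~~ hlt k.1)) lin_step.
rewrite lin_step [X in N X](_ : _ = 0) // /lin big_seq big1 // => c.
move=> /(allP cfgN) qN.
rewrite /pull big1 ?mulr0 // => p' _; rewrite /at_config xpair_eqE.
case: (p' =P p) => [->|_]; last by rewrite mulr0.
by case: a aE => [a| |] // _; rewrite ?VL ?VE ?mul0r.
Qed.

Lemma pullback_cons (A : pzRingType) (Q : finType) (S1 : Type) (S2 : eqType)
    (V : sym S1 -> Q -> Q -> A) (f : sym S1 -> Q -> seq S2) hlt a s g :
  pullback V f hlt (a :: s) g =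
  pull (V a) (f a) (fun k => if ~~ hlt k.1 then pullback V f hlt s g k else 0).
Proof. by []. Qed.

(** The first component of a state names its copy; letters and the right end marker preserve it, so
    no amplitude passes between copies. *)
Lemma pullback_block (A : pzRingType) (S1 : Type) (S2 : eqType) (I J : finType)
    (V : sym S1 -> I * J -> I * J -> A) f hlt :
  (forall a q p, q.1 != p.1 -> V (Letter a) q p = 0) ->
  (forall q p, q.1 != p.1 -> V REnd q p = 0) ->
  forall v p q (w x : seq S2), q.1 != p.1 ->
  pullback V f hlt (map (@Letter S1) v) (at_config p x) (q, w) = 0.
Proof.
move=> VL VR; elim=> [|a v IH] p q w x qp /=; apply: big1 => r _ /=;
  (have [qr|qr] := eqVneq q.1 r.1; last by rewrite ?VL ?VR ?mul0r //).
  rewrite /at_config xpair_eqE; case: (r =P p) => [rp|_]; last by rewrite mulr0.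
  by rewrite -rp qr eqxx in qp.
by rewrite IH ?if_same ?mulr0 // -qr.
Qed.

(** * Permutation steps and Householder reflections *)

Section Householder.
Context {A : fieldType} {Q : finType}.

Definition perm_step (s : {perm Q}) (i j : Q) : A := (s i == j)%:R.

(** With these signs the reflection sends [k0] to half the sum of all four basis vectors. *)
Definition quad (k0 k1 k2 k3 i : Q) : A :=
  (i == k0)%:R - (i == k1)%:R - (i == k2)%:R - (i == k3)%:R.

(* The permutation [s] followed by the Householder reflection along [quad],
   which acts on [k0, k1, k2, k3] as half a 4 x 4 Hadamard matrix. *)
Definition hadamard_step (s : {perm Q}) (k0 k1 k2 k3 i j : Q) : A :=
  (s i == j)%:R - 2^-1 * quad k0 k1 k2 k3 (s i) * quad k0 k1 k2 k3 j.

Lemma sum_delta (i : Q) (g : Q -> A) : \sum_j (i == j)%:R * g j = g i.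
Proof.
rewrite (bigD1 i) //= eqxx mul1r big1 ?addr0 // => j /negbTE.
by rewrite eq_sym => ->; rewrite mul0r.
Qed.

Lemma pull_perm (S2 : eqType) (nx : Q -> Q) f (g : Q * seq S2 -> A) q w :
  pull (fun q p => (nx q == p)%:R) f g (q, w) = g (nx q, w ++ f q).
Proof. exact: (sum_delta _ (fun p => g (p, w ++ f q))). Qed.

Lemma sum_quad k0 k1 k2 k3 (g : Q -> A) :
  \sum_j quad k0 k1 k2 k3 j * g j = g k0 - g k1 - g k2 - g k3.
Proof.
rewrite -!(sum_delta _ g) -!sumrB; apply: eq_bigr => j _.
by rewrite /quad !mulrBl ![j == _]eq_sym.
Qed.

Lemma sum_hadamard_step s k0 k1 k2 k3 i (g : Q -> A) :
  \sum_j hadamard_step s k0 k1 k2 k3 i j * g j =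
  g (s i) - 2^-1 * quad k0 k1 k2 k3 (s i) * (g k0 - g k1 - g k2 - g k3).
Proof.
rewrite -sum_quad mulr_sumr -[g (s i)](sum_delta _ g) -sumrB.
by apply: eq_bigr => j _; rewrite mulrBl mulrA.
Qed.

(** Squared norm 4 makes the factor [2^-1] in [hadamard_step] the one of a reflection, 2 over the
    squared norm. *)
Lemma quad_quad k0 k1 k2 k3 : uniq [:: k0; k1; k2; k3] ->
  \sum_j quad k0 k1 k2 k3 j * quad k0 k1 k2 k3 j = 4.
Proof.
move=> /=; rewrite !inE !negb_or.
move=> /and4P[/and3P[/negbTE n01 /negbTE n02 /negbTE n03]].
move=> /andP[/negbTE n12 /negbTE n13] /negbTE n23 _.
rewrite sum_quad /quad !eqxx.
rewrite ![k1 == k0]eq_sym ![k2 == k0]eq_sym ![k3 == k0]eq_sym.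
rewrite ![k2 == k1]eq_sym ![k3 == k1]eq_sym ![k3 == k2]eq_sym.
rewrite n01 n02 n03 n12 n13 n23.
by rewrite !(mulr1n, mulr0n); ring.
Qed.

End Householder.

Lemma pull_block (A : fieldType) (I J : finType) (S2 : eqType)
    (W : I -> J -> J -> A) f (g : I * J * seq S2 -> A) c i w :
  pull (fun q p : I * J => (q.1 == p.1)%:R * W q.1 q.2 p.2) f g ((c, i), w) =
  \sum_j W c i j * g ((c, j), w ++ f (c, i)).
Proof.
pose F d j := (c == d)%:R * W c i j * g ((d, j), w ++ f (c, i)).
rewrite /pull (eq_bigr (fun p => F p.1 p.2)) => [|[d j] _] //.
rewrite -(pair_bigA _ F) /F.
under eq_bigr => d _.
  under eq_bigr do rewrite -mulrA.
  rewrite -mulr_sumr; over.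
by rewrite (sum_delta c (fun d => \sum_j W c i j * g ((d, j), w ++ f (c, i)))).
Qed.

(** * Unitarity of the building blocks *)

Section Unitary.
Context {R : realType}.

Lemma perm_step_unitary (Q : finType) (s : {perm Q}) :
  q_unitary (perm_step s : Q -> Q -> R[i]).
Proof.
move=> q q'; rewrite /perm_step.
rewrite (sum_delta (s q) (fun p => ((s q' == p)%:R : R[i])^*)) conjC_nat.
by rewrite (inj_eq perm_inj) eq_sym.
Qed.

Lemma hadamard_step_unitary (Q : finType) (s : {perm Q}) k0 k1 k2 k3 :
  uniq [:: k0; k1; k2; k3] ->
  q_unitary (hadamard_step s k0 k1 k2 k3 : Q -> Q -> R[i]).
Proof.
move=> k_uniq q q'.
have conj_quad i : (quad k0 k1 k2 k3 i : R[i])^* = quad k0 k1 k2 k3 i.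
  by rewrite !rmorphB !rmorph_nat.
have conj_had i : (hadamard_step s k0 k1 k2 k3 q' i : R[i])^* =
    hadamard_step s k0 k1 k2 k3 q' i.
  by rewrite rmorphB !rmorphM /= !conj_quad fmorphV !rmorph_nat.
under eq_bigr do rewrite conj_had mulrC.
rewrite sum_hadamard_step -sum_quad /hadamard_step.
under eq_bigr do rewrite mulrBr mulrCA.
rewrite sumrB -mulr_sumr quad_quad // sum_quad.
rewrite (inj_eq perm_inj).
set a := quad _ _ _ _ (s q); set b := quad _ _ _ _ (s q').
rewrite [X in _ - _ * _ * (X - _)](_ : _ = a) //.
by field.
Qed.

Lemma block_unitary (I J : finType) (W : I -> J -> J -> R[i]) :
  (forall c, q_unitary (W c)) ->
  q_unitary (fun q p : I * J => (q.1 == p.1)%:R * W q.1 q.2 p.2).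
Proof.
move=> Wu [c i] [c' i'] /=.
rewrite -(pair_bigA _ (fun d j =>
  (c == d)%:R * W c i j * ((c' == d)%:R * W c' i' j)^*)) /=.
under eq_bigr => d _. 
  under eq_bigr do rewrite rmorphM rmorph_nat -mulrA.
  rewrite -mulr_sumr; over.
rewrite sum_delta xpair_eqE [c' == c]eq_sym.
case: (c =P c') => [<-|_]; last by rewrite big1 // => j _; rewrite mul0r mulr0.
by rewrite -(Wu c); apply: eq_bigr => j _; rewrite mul1r.
Qed.

End Unitary.

(** * The two-copy transducers *)

Section CopyFormat.

(** The copy [true] outputs the 0s, the copy [false] the 1s. *)
Definition gain (c : bool) (k : nat) : nat :=
  (k == 0%N) && c || (k == 1%N) && ~~ c.

Definition final (c : bool) : nat := if c then 2 else 3.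

(* [word_out c v] is the number of letters 0 (for [c = true]) or 1 (for
   [c = false]) of [v] if [v] has the form 0^m 1^n a, where a is [final c];
   [tail_out c] does the same for the form 1^n a. *)
Fixpoint tail_out (c : bool) (v : seq Sigma1) : option nat :=
  if v is a :: u then
    if val a == 1%N then omap (addn (gain c 1)) (tail_out c u)
    else if (val a == final c) && nilp u then Some 0%N else None
  else None.

Fixpoint word_out (c : bool) (v : seq Sigma1) : option nat :=
  if v is a :: u then
    if val a == 0%N then omap (addn (gain c 0)) (word_out c u) else tail_out c v
  else None.

Lemma val_sym4 k : (k < 4)%N -> val (sym4 k) = k.
Proof. exact: inordK. Qed.

Lemma sym4_val (a : Sigma1) k : val a = k -> a = sym4 k.
Proof. by move=> <-; rewrite /sym4 inord_val. Qed.

Lemma tail_outP c v l : tail_out c v = Some l <->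
  exists2 n, v = nseq n (sym4 1) ++ [:: sym4 (final c)] & l = (n * gain c 1)%N.
Proof.
elim: v l => [|a u IH] l /=; first by split=> // -[[]].
case: eqP => [/sym4_val ->|a1].
  split.
    case E: (tail_out c u) => [l'|] //= [<-].
    by have [n -> ->] := (IH l').1 E; exists n.+1.
  case=> -[|n] /=.
    by move=> [/(congr1 val)]; rewrite !val_sym4 //; case: (c).
  by move=> [uE] ->; rewrite ((IH (n * gain c 1)%N).2 _) //; exists n.
have fc : (final c < 4)%N by case: (c).
case: andP => [[/eqP/sym4_val -> /nilP ->]|nf]; split=> //.
- by move=> [<-]; exists 0%N.
- case=> -[|n] /=; first by move=> _ ->.
  by move=> [/(congr1 val)]; rewrite !val_sym4 //; case: (c).
- case=> -[|n] /= [aE].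
    by move=> uE; case: nf; rewrite uE aE val_sym4.
  by case: a1; rewrite aE val_sym4.
Qed.

Lemma word_outP c v l : word_out c v = Some l <->
  exists m n, v = nseq m (sym4 0) ++ nseq n (sym4 1) ++ [:: sym4 (final c)]
    /\ l = (m * gain c 0 + n * gain c 1)%N.
Proof.
elim: v l => [|a u IH] l; first by split=> // -[[|m] [[|n] []]].
have fc : (final c < 4)%N by case: (c).
rewrite [word_out _ _]/=; case: eqP => [/sym4_val ->|a0].
  split.
    case E: (word_out c u) => [l'|] //= [<-].
    by have [m [n [-> ->]]] := (IH l').1 E; exists m.+1, n; rewrite mulSn addnA.
  case=> -[|m] [n [/= uE ->]].
    case: n uE => [|n] /= [/(congr1 val)]; rewrite !val_sym4 //; by case: (c).
  case: uE => uE; rewrite ((IH (m * gain c 0 + n * gain c 1)%N).2 _).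
    by rewrite /= mulSn addnA.
  by exists m, n.
rewrite -/(tail_out c (a :: u)) tail_outP.
split=> [[n -> ->]|[[|m] [n [uE ->]]]].
- by exists 0%N, n.
- by exists n.
- by case: a0; case: uE => -> _; rewrite val_sym4.
Qed.

(** The copy [c] is tied to one final letter, and [gain c] counts just the block whose length [R4]
    demands for that letter. *)
Lemma R4P v w : R4 v w <-> exists c, word_out c v = Some (size w).
Proof.
split.
  case=> m [n [l [a [aE -> -> l2 l3]]]]; case: aE l2 l3 => [->|->] l2 l3.
    exists true; apply/word_outP; exists m, n.
    by rewrite size_nseq l2 // /gain /= muln1 muln0 addn0.
  exists false; apply/word_outP; exists m, n.
  by rewrite size_nseq l3 // /gain /= muln1 muln0.
have wE : w = nseq (size w) tt by elim: w => //= -[] w <-.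
case=> c /word_outP[m [n [-> sw]]]; exists m, n, (size w), (sym4 (final c)).
case: c sw => sw; rewrite /gain /= ?muln0 ?muln1 ?addn0 in sw.
- by split; [left|by []|by []|by []|move/sym4_23].
- by split; [right|by []|by []|move/esym/sym4_23|by []].
Qed.

Definition hit (R : pzRingType) (o : option nat) (w x : seq unit) : R :=
  if o is Some l then (w ++ nseq l tt == x)%:R else 0.

Lemma hit_addn (R : pzRingType) o k w x :
  hit R (omap (addn k) o) w x = hit R o (w ++ nseq k tt) x.
Proof. by case: o => //= l; rewrite -catA -nseqD. Qed.

Lemma hit_nil (R : pzRingType) o x : hit R o [::] x = (o == Some (size x))%:R.
Proof.
case: o => //= l; congr (_%:R); congr nat_of_bool.
apply/eqP/eqP => [<-|[->]]; first by rewrite size_nseq.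
by elim: x => //= -[] x ->.
Qed.

End CopyFormat.

(** * States and transition rules of the two machines *)

Section Machines.
Context {R : realType}.

Notation "# k" := (@Ordinal 8 k isT) (at level 2, format "# k").

Definition cstate : finType := (bool * 'I_8)%type.

(* In the copy [c], #0 is the initial state, #1 reads the block of 0s, #2 the
   block of 1s, #3 has read the final letter, #4 accepts, #5 to #7 reject. *)
Definition cacc : {set cstate} := [set q : cstate | val q.2 == 4%N].
Definition crej : {set cstate} := [set q : cstate | (4 < val q.2)%N].

Definition cout (a : sym Sigma1) (q : cstate) : seq Sigma2 :=
  if a is Letter k then nseq (gain q.1 k) tt else [::].

Definition prob_next (c : bool) (a : sym Sigma1) (i : 'I_8) : 'I_8 :=
  match a with
  | Letter k =>
      if val k == 0%N then (if val i == 1%N then #1 else #5)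
      else if val k == 1%N then (if 0 < val i < 3 then #2 else #5)%N
      else if val k == final c then (if 0 < val i < 3 then #3 else #5)%N
      else #5
  | REnd => if val i == 3 then #4 else #5
  | LEnd => #5
  end.

Definition prob_copier : pfst R Sigma1 Sigma2 := {|
  pstate := cstate;
  pV := fun a q p =>
    if a is LEnd then
      2^-1 * ((true, #1) == p)%:R + 2^-1 * ((false, #1) == p)%:R
    else ((q.1, prob_next q.1 a q.2) == p)%:R;
  pf := cout;
  pq0 := (true, #0);
  pacc := cacc;
  prej := crej |}.

(** Reading 0 fixes #1 + #2 and sends #1 - #2 to the rejecting #5 + #6. Reading 1 keeps #2 and
    rejects #1; the final letter moves #2 to #3. States to be rejected are permuted with rejecting
    ones, which keeps each step unitary. *)
Definition letter_step (c : bool) (k : nat) : 'I_8 -> 'I_8 -> R[i] :=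
  if k == 0%N then hadamard_step (tperm #3 #7) #1 #2 #5 #6
  else if k == 1%N then perm_step (tperm #1 #5 * tperm #3 #7)%g
  else if k == final c then
    perm_step (tperm #2 #3 * tperm #2 #6 * tperm #1 #5)%g
  else perm_step (tperm #1 #5 * tperm #2 #6 * tperm #3 #7)%g.

Definition end_step : 'I_8 -> 'I_8 -> R[i] :=
  perm_step (tperm #0 #5 * tperm #1 #6 * tperm #2 #7 * tperm #3 #4)%g.

(** Sends the initial state to half of #1 + #2 in each copy. *)
Definition start_step : cstate -> cstate -> R[i] :=
  hadamard_step (tperm (true, #0) (true, #1))
    (true, #1) (true, #2) (false, #1) (false, #2).

Definition quantum_step (a : sym Sigma1) : cstate -> cstate -> R[i] :=
  match a with
  | Letter k => fun q p => (q.1 == p.1)%:R * letter_step q.1 (val k) q.2 p.2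
  | REnd => fun q p => (q.1 == p.1)%:R * end_step q.2 p.2
  | LEnd => start_step
  end.

Definition quantum_copier : qfst R Sigma1 Sigma2 := {|
  qstate := cstate;
  qV := quantum_step;
  qf := cout;
  qq0 := (true, #0);
  qacc := cacc;
  qrej := crej |}.

Definition chalting (q : cstate) : bool := (q \in cacc) || (q \in crej).

Lemma chaltingE q : chalting q = (4 <= val q.2)%N.
Proof. by rewrite /chalting !inE [RHS]leq_eqVlt eq_sym. Qed.

Lemma cacc_crej : [disjoint cacc & crej].
Proof.
by rewrite disjoint_subset; apply/subsetP=> q; rewrite !inE => /eqP ->.
Qed.

Lemma big_cacc (F : cstate -> R) :
  \sum_(p in cacc) F p = F (true, #4) + F (false, #4).
Proof.
rewrite (bigD1 (true, #4)) ?inE //= (bigD1 (false, #4)) ?inE //= big1 ?addr0 //.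
move=> [c i]; rewrite !inE /= !xpair_eqE => /andP[/andP[i4 n1] n2].
have iE : i = #4 by apply/val_inj/eqP.
by move: n1 n2; rewrite iE eqxx; case: (c).
Qed.

(** * Well-formedness of both machines *)

Lemma prob_copier_wf : pfst_wf prob_copier.
Proof.
split.
- exact: cacc_crej.
- by rewrite -[p_halting _ _]/(chalting _) chaltingE.
- move=> [k| |] q p /=; rewrite ?ler0n //.
  by rewrite addr_ge0 // mulr_ge0 // ?invr_ge0 ler0n.
- move=> a q.
  have sum1 (p : cstate) : \sum_p' (p == p')%:R = 1 :> R.
    by rewrite -[RHS](sum_delta p (fun=> 1)); apply: eq_bigr => ? _;
      rewrite mulr1.
  case: a => [k| |] /=; rewrite ?sum1 //.
  by rewrite big_split /= -!mulr_sumr !sum1; lra.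
- move=> [c i] [d j]; rewrite -[p_halting _ _]/(chalting _) chaltingE /=.
  case: eqP => // -[_ <-]; by case: ifP.
Qed.

Lemma quantum_copier_wf : qfst_wf quantum_copier.
Proof.
split.
- exact: cacc_crej.
- by rewrite -[q_halting _ _]/(chalting _) chaltingE.
- move=> [k| |] /=.
  + apply: (block_unitary (W := fun c => letter_step c (val k))) => c.
    rewrite /letter_step; do 3?case: ifP => _; try exact: perm_step_unitary.
    exact: hadamard_step_unitary.
  + exact: hadamard_step_unitary.
  + apply: (block_unitary (W := fun=> end_step)) => _.
    exact: perm_step_unitary.
- move=> q p; rewrite -![q_halting _ _]/(chalting _) !chaltingE.
  case: q p => [c i] [d j] /=; rewrite -!ltnNge.
  rewrite /end_step /perm_step !permM => i4 j4.
  case: (c =P d) => _; last by rewrite mul0r.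
  case: eqP => [e|_]; last by rewrite mulr0.
  suff: (4 <= j)%N by rewrite leqNgt j4.
  rewrite -{}e; by case: i i4 => [[|[|[|[|i]]]] Hi] //= _; rewrite !permE.
Qed.

(** * Acceptance by the probabilistic machine *)

(** The three states need a joint induction, since a letter may lead from #1 to #2 and from either
    to #3. *)
Lemma prob_pullback c v w x :
  let h i := pullback (pV prob_copier) cout chalting (map (@Letter _) v)
               (at_config (c, #4) x) ((c, i), w) in
  [/\ h #1 = hit R (word_out c v) w x, h #2 = hit R (tail_out c v) w x &
      h #3 = (nilp v && (w == x))%:R].
Proof.
elim: v w => [|k u IH] w h.
  by rewrite /h /= !pull_perm /at_config /= !xpair_eqE /= cats0 eqxx.
have [] := IH (w ++ nseq (gain c k) tt).
rewrite /h; set F := pullback _ _ _ => h1 h2 h3.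
rewrite [map _ _]/= [F _ _]/= !pull_perm /= !chaltingE -/F.
case: (k =P 0%N :> nat) h1 h2 h3 => [->|_].
  by rewrite /= hit_addn => -> _ _; case: (c).
case: (k =P 1%N :> nat) => [->|_]; first by rewrite /= !hit_addn => _ -> _.
case: (k =P final c :> nat) => [->|_] //= _ _.
have -> : gain c (final c) = 0%N by case: (c).
by rewrite cats0 => ->; case: (nilp u); rewrite /= ?cats0.
Qed.

Lemma prob_pullback_block c v w x q : q.1 != c ->
  pullback (pV prob_copier) cout chalting (map (@Letter _) v)
    (at_config (c, #4) x) (q, w) = 0.
Proof.
move=> qc; apply: pullback_block => // [a|] p p' pp' /=;
by case: eqP => // pE; rewrite -pE eqxx in pp'.
Qed.

Lemma prob_start (g : cstate * seq Sigma2 -> R) :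
  pull (pV prob_copier LEnd) (cout LEnd) g ((true, #0), [::]) =
  2^-1 * g ((true, #1), [::]) + 2^-1 * g ((false, #1), [::]).
Proof.
rewrite /pull /=; under eq_bigr do rewrite mulrDl -!mulrA.
rewrite big_split -!mulr_sumr /=; pose g' p := g (p, [::]).
by rewrite (sum_delta _ g') (sum_delta _ g').
Qed.

Lemma caccP q : q \in cacc -> q.2 = #4.
Proof. by rewrite inE => /eqP q4; apply: val_inj. Qed.

Lemma prob_copierE v x : pT prob_copier x v =
  2^-1 * (word_out true v == Some (size x))%:R +
  2^-1 * (word_out false v == Some (size x))%:R.
Proof.
rewrite /pT prun_run (@run_accept_at_end _ _ _ _ _ _ _ cacc _ id) //.
- rewrite big_cacc !lin_seq1 !pullback_cons.
  rewrite !prob_start -![p_halting _]/chalting !chaltingE ![~~ _]/=.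
  have [-> _ _] := prob_pullback true v [::] x.
  have [-> _ _] := prob_pullback false v [::] x.
  by rewrite !prob_pullback_block // !hit_nil !mulr0 addr0 add0r.
- by move=> cfg y; rewrite paccpE.
- move=> a [c i] p _ /caccP p4 /=; case: eqP => // pE.
  by move: p4; rewrite -pE /=; do !case: ifP => _.
- by move=> q [d j] _ /caccP /= ->; rewrite !xpair_eqE /= !andbF !mulr0 addr0.
- by rewrite /= andbT -[p_halting _]/chalting chaltingE.
Qed.

Lemma prob_copier_isolated : computes_isolated (pT prob_copier) R4.
Proof.
(* The probability is at least 1/2 on related pairs and 0 on all others; 1/4 is the midpoint. *)
exists 4^-1, 4^-1; split; [lra|lra|lra|] => v w; rewrite prob_copierE R4P.
split=> [[[] ->]|nR]; first by rewrite eqxx; case: (_ == _); rewrite /=; lra.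
  by rewrite eqxx; case: (_ == _); rewrite /=; lra.
case: eqP => [e|_]; first by case: nR; exists true.
by case: eqP => [e|_]; [case: nR; exists false|rewrite /=; lra].
Qed.

(** * Acceptance by the quantum machine *)

Lemma pull_quantum k (g : cstate * seq Sigma2 -> R[i]) c i w :
  pull (quantum_step (Letter k)) (cout (Letter k)) g ((c, i), w) =
  \sum_j letter_step c k i j * g ((c, j), w ++ nseq (gain c k) tt).
Proof. exact: (pull_block (fun c => letter_step c k)). Qed.

Lemma pull_quantum_end (g : cstate * seq Sigma2 -> R[i]) c i w :
  pull (quantum_step REnd) (cout REnd) g ((c, i), w) =
  g ((c, (tperm #0 #5 * tperm #1 #6 * tperm #2 #7 * tperm #3 #4)%g i), w).
Proof.
rewrite [LHS](pull_block (fun=> end_step)) cats0 /end_step /perm_step.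
exact: (sum_delta _ (fun j => g ((c, j), w))).
Qed.

(** [g] vanishes on halting states because a run continues only with the non-halting part. *)
Lemma sum_letter_step c k (g : 'I_8 -> R[i]) :
  (forall j : 'I_8, (4 <= j)%N -> g j = 0) ->
  [/\ \sum_j letter_step c k #1 j * g j =
       if k == 0%N then 2^-1 * (g #1 + g #2) else 0,
      \sum_j letter_step c k #2 j * g j =
       if k == 0%N then 2^-1 * (g #1 + g #2)
       else if k == 1%N then g #2 else if k == final c then g #3 else 0 &
      \sum_j letter_step c k #3 j * g j = 0].
Proof.
move=> g0; rewrite /letter_step.
have [g5 g6 g7] : [/\ g #5 = 0, g #6 = 0 & g #7 = 0] by split; apply: g0.
case: ifP => [_|_]; last case: ifP => [_|_]; last case: ifP => [_|_];
  rewrite ?sum_hadamard_step ?sum_delta !permE /=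
    ?permM ?permE /= ?g5 ?g6 ?g7 //.
by rewrite /quad /=; split; field.
Qed.

Lemma quantum_pullback_cons c (k : Sigma1) u x w :
  let h v w i := pullback (qV quantum_copier) cout chalting
    (map (@Letter _) v) (at_config (c, #4) x) ((c, i), w) in
  let h' := h u (w ++ nseq (gain c k) tt) in
  [/\ h (k :: u) w #1 = if k == 0%N :> nat then 2^-1 * (h' #1 + h' #2) else 0,
      h (k :: u) w #2 = if k == 0%N :> nat then 2^-1 * (h' #1 + h' #2)
        else if k == 1%N :> nat then h' #2
        else if k == final c :> nat then h' #3 else 0 &
      h (k :: u) w #3 = 0].
Proof.
move=> h h'; pose g i := if (4 <= val i)%N then 0 else h' i.
have hE i : h (k :: u) w i = \sum_j letter_step c k i j * g j.
  rewrite /h [map _ _]/= pullback_cons [LHS]pull_quantum.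
  by apply: eq_bigr => j _; rewrite chaltingE /g if_neg.
by rewrite !hE; apply: (@sum_letter_step c k g) => j j4; rewrite /g j4.
Qed.

(** The amplitude is exact on words of the right form; on malformed ones the bound 1/2 suffices. *)
Definition copy_approx (o : option nat) (w x : seq unit) (t : R) : Prop :=
  if isSome o then t = hit R o w x else 0 <= t <= 2^-1.

Lemma copy_approx_addn o k w x t :
  copy_approx o (w ++ nseq k tt) x t -> copy_approx (omap (addn k) o) w x t.
Proof. by rewrite /copy_approx hit_addn; case: o. Qed.

Lemma copy_approx_le1 o w x t : copy_approx o w x t -> 0 <= t <= 1.
Proof.
rewrite /copy_approx; case: o => [l|] /=; last by lra.
by move=> ->; case: (_ == _); rewrite /= ?ler01 lexx.
Qed.

Lemma quantum_pullback_final c v w x :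
  pullback (qV quantum_copier) cout chalting (map (@Letter _) v)
    (at_config (c, #4) x) ((c, #3), w) = (nilp v && (w == x))%:R.
Proof.
case: v => [|k u]; last by have [] := quantum_pullback_cons c k u x w.
by rewrite [LHS]pull_quantum_end !permM !permE /= /at_config xpair_eqE eqxx.
Qed.

(** The vector #1 + #2 is the one inside the block of 0s and #2 the one inside the block of 1s, so
    [a + b] follows [word_out] and [b] follows [tail_out]. *)
Lemma quantum_pullback c v w x :
  let h i := pullback (qV quantum_copier) cout chalting (map (@Letter _) v)
               (at_config (c, #4) x) ((c, i), w) in
  exists a b : R, [/\ h #1 = a%:C%C, h #2 = b%:C%C,
    copy_approx (word_out c v) w x (a + b) & copy_approx (tail_out c v) w x b].
Proof.
elim: v w => [|k u IH] w h; rewrite {}/h.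
  exists 0, 0; rewrite ![pullback _ _ _ _ _]/= !pull_quantum_end.
  rewrite !permM !permE /= /at_config !xpair_eqE.
  by rewrite eqxx /copy_approx /= addr0 rmorph0; split=> //; lra.
have [a [b [ha hb ab_approx b_approx]]] := IH (w ++ nseq (gain c k) tt).
have [-> -> _] := quantum_pullback_cons c k u x w.
rewrite ha hb quantum_pullback_final [word_out _ _]/= [tail_out _ (k :: u)]/=.
have half : 0 <= (0 : R) <= 2^-1 by lra.
case: (k =P 0%N :> nat) ab_approx b_approx => [->|_].
  (* The sum is unchanged by a 0, while #2 alone receives half of it. A word starting with 0 has no
     [tail_out], and half of a number at most 1 meets the bound. *)
  move=> ab_approx _; exists (2^-1 * (a + b)), (2^-1 * (a + b)).
  rewrite rmorphM rmorphD fmorphV rmorph_nat; split=> //.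
    rewrite (_ : _ + _ = a + b); last by field.
    exact: copy_approx_addn.
  have := copy_approx_le1 ab_approx.
  by rewrite /copy_approx; case: (c) => /=; lra.
case: (k =P 1%N :> nat) => [->|_].
  move=> _ /copy_approx_addn b_approx; exists 0, b.
  by rewrite rmorph0 add0r.
case: (k =P final c :> nat) => [->|_] _ _ /=; last first.
  by exists 0, 0; rewrite rmorph0 addr0.
have -> : gain c (final c) = 0%N by case: (c).
exists 0, (nilp u && (w == x))%:R; rewrite rmorph0 rmorph_nat add0r cats0.
by split=> //; rewrite /copy_approx; case: (nilp u); rewrite //= cats0.
Qed.

Lemma quantum_pullback_block c v w x q : q.1 != c ->
  pullback (qV quantum_copier) cout chalting (map (@Letter _) v)
    (at_config (c, #4) x) (q, w) = 0.
Proof.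
move=> qc; apply: pullback_block => // [a|] p p' pp' /=;
by rewrite (negbTE pp') mul0r.
Qed.

Lemma quantum_start (g : cstate * seq Sigma2 -> R[i]) :
  pull (qV quantum_copier LEnd) (cout LEnd) g ((true, #0), [::]) =
  2^-1 * (g ((true, #1), [::]) + g ((true, #2), [::]) +
          g ((false, #1), [::]) + g ((false, #2), [::])).
Proof.
pose g' p := g (p, [::]).
rewrite [LHS](sum_hadamard_step _ _ _ _ _ _ g') /g' permE /=.
by rewrite /quad /=; field.
Qed.

Lemma csqnorm_real (t : R) : csqnorm (t%:C%C) = t ^+ 2.
Proof. by rewrite /csqnorm /= expr0n addr0. Qed.

(** Each copy starts with amplitude 1/2 on both #1 and #2, hence accepts with half the sum of their
    two pullbacks. *)
Lemma quantum_copierE v x : exists s : bool -> R,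
  qT quantum_copier x v = (2^-1 * s true) ^+ 2 + (2^-1 * s false) ^+ 2 /\
  forall c, copy_approx (word_out c v) [::] x (s c).
Proof.
have [a [b [ha hb ab _]]] := quantum_pullback true v [::] x.
have [a' [b' [ha' hb' ab' _]]] := quantum_pullback false v [::] x.
exists (fun c => if c then a + b else a' + b'); split; last by case.
rewrite /qT qrun_run (@run_accept_at_end _ _ _ _ _ _ _ cacc _ (@csqnorm R)).
- rewrite big_cacc !lin_seq1 !pullback_cons.
  rewrite !quantum_start -![q_halting _]/chalting !chaltingE ![~~ _]/=.
  rewrite ha hb ha' hb' !quantum_pullback_block // !addr0 !add0r.
  by rewrite -!csqnorm_real !(rmorphM, rmorphD, fmorphV, rmorph_nat).
- by rewrite /csqnorm /= expr0n addr0.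
- by move=> cfg y; rewrite qacc_prob_lin.
- move=> k [c i] [d j]; rewrite -[q_halting _]/chalting chaltingE.
  move=> + /caccP /= ->.
  move=> i4; rewrite /= /letter_step.
  have i_neq4 : i != #4 by apply: contraNneq i4 => ->.
  (* Every permutation used for a letter fixes #4, and the reflection vector vanishes there. *)
  have pm (s : {perm 'I_8}) : s #4 = #4 -> (s i == #4)%:R = 0 :> R[i].
    by move=> s4; rewrite -s4 (inj_eq perm_inj) (negbTE i_neq4).
  do 3?case: ifP => _;
    rewrite /hadamard_step /perm_step pm ?permM ?permE ?mulr0 //.
  by rewrite /quad /= !subr0 mulr0 subr0 mulr0.
- move=> [c i] [d j]; rewrite -[q_halting _]/chalting chaltingE.
  move=> + /caccP /= ->.
  move=> i4; have i_neq4 : i != #4 by apply: contraNneq i4 => ->.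
  rewrite /start_step /hadamard_step /quad !xpair_eqE /= !andbF.
  rewrite !subr0 mulr0 subr0.
  case: tpermP => [_|_|_ _]; rewrite xpair_eqE ?andbF //.
  by rewrite (negbTE i_neq4) andbF.
- by rewrite /= andbT -[q_halting _]/chalting chaltingE.
Qed.

Lemma quantum_copier_isolated : computes_isolated (qT quantum_copier) R4.
Proof.
(* The midpoint and half the gap between 1/8, the bound for unrelated pairs, and 1/4, reached by one
   accepting copy. *)
exists (3 / 16), (1 / 16); split; [lra|lra|lra|] => v w; rewrite R4P.
have [s [-> sP]] := quantum_copierE v w.
split=> [[c]|nR].
  have := sP c; rewrite /copy_approx => + cE; rewrite cE /= => sc.
  have s1 : s c = 1.
    by rewrite sc; have := hit_nil R (Some (size w)) w; rewrite /= eqxx.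
  have := sqr_ge0 (2^-1 * s (~~ c)).
  by case: c {cE sc} s1 => /= -> ; lra.
(* For a word of the right form the output is wrong and the amplitude 0; otherwise the bound 1/2
   applies. Two copies then give at most 2 * (1/4)^2 = 1/8. *)
have small c : 0 <= s c <= 2^-1.
  have := sP c; rewrite /copy_approx hit_nil; case: ifP => // _ ->.
  by case: eqP => [e|_]; [case: nR; exists c|rewrite /=; lra].
by have := small true; have := small false; nra.
Qed.

End Machines.

Theorem theorem9 (R : realType) :
  [/\ (exists T : pfst R Sigma1 Sigma2,
         pfst_wf T /\ computes_isolated (pT T) R4),
      (exists T : qfst R Sigma1 Sigma2,
         qfst_wf T /\ computes_isolated (qT T) R4),
      (forall alpha : R, 1 / 2 < alpha ->
         ~ exists T : pfst R Sigma1 Sigma2,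
             pfst_wf T /\ computes_with_prob (pT T) R4 alpha) &
      (forall alpha : R, 1 / 2 < alpha ->
         ~ exists T : qfst R Sigma1 Sigma2,
             qfst_wf T /\ computes_with_prob (qT T) R4 alpha)].
Proof.
split.
- exists prob_copier.
  by split; [exact: prob_copier_wf|exact: prob_copier_isolated].
- exists quantum_copier.
  by split; [exact: quantum_copier_wf|exact: quantum_copier_isolated].
- by move=> alpha ha [T [Twf]]; apply: pfst_no_majority.
- by move=> alpha ha [T [Twf]]; apply: qfst_no_majority.
Qed.
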